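(* Consider the system $x(t+1)=f(x(t),u(t))$ and the iterative RAMPC scheme described in the context, with data $x_0,\mathcal X,\mathcal T,\mathcal U,h,\lambda,M,N,K$, under the stated standing assumptions. Then for each iteration $1\le j\le K$: (i) the RAMPC optimization problem $\mathrm{RAMPC}(j,t)$ is feasible for $1\le t\le L^j-1$ (for those times $t$ at which it is to be solved, i.e. as long as iteration $j$ has not been terminated by the stopping rule); (ii) the system with the controllers obtained by solving $\mathrm{RAMPC}(j,\cdot)$ reaches, starting from $x_0$, the target set $\mathcal T$ within the time interval $\left[0,\log_\lambda\frac{M}{v^{j-1}(x_0)}\right]$ while satisfying all state and input constraints (i.e. $x^j(i)\in\mathcal X$ and $u^j(i)\in\mathcal U$ for all $0\le i\le L^j-1$, $x^j(L^j)\in\mathcal T$, and $L^j\le\log_\lambda\frac{M}{v^{j-1}(x_0)}$).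
   Context: **System and sets.** $f:\mathbb R^n\times\mathbb R^m\to\mathbb R^n$, $\mathcal U\subseteq\mathbb R^m$ is the control input set, $\mathcal X=\{x\in\mathbb R^n\mid w(x)\le 0\}$ is the safe set, $\mathcal T=\{x\in\mathbb R^n\mid g(x)\le 0\}\subseteq\mathcal X$ is the target set, $x_0\in\mathcal X\setminus\mathcal T$ is the initial state, and $\mathcal Y=\{f(x,u)\mid x\in\mathcal X,u\in\mathcal U\}\cup\mathcal X$. The stage cost $h$ is continuous with $h(x,u)\ge 0$ for all $(x,u)\in\mathcal X\times\mathcal U$. Fixed parameters: $\lambda\in(1,\infty)$, $M>0$, prediction horizon $N$, maximum iteration number $K$. **Guidance-barrier function.** Given a feedback controller $\hat u:\mathcal X\to\mathcal U$, a bounded function $v:\mathcal Y\to\mathbb R$ is a guidance-barrier function of the system with $\hat u$ if $v(f(x,\hat u(x)))\ge\lambda v(x)$ for all $x\in\mathcal X\setminus\mathcal T$; $v(x)\le 0$ for all $x\in\mathcal Y\setminus\mathcal X$; $v(x)\le M$ for all $x\in\mathcal T$; and $v(x_0)>0$. **Terminal cost.** For a feedback controller $\hat u$, let $\pi_{\hat u}$ be the policy applying $\hat u(x(i))$ in state $x(i)$. For a state $x$ from which $\pi_{\hat u}$ drives the system to $\mathcal T$ in finite time while staying in $\mathcal X$ until the first hitting time, $Q(x,\pi_{\hat u})=\sum_{k=0}^{L-1}h(x(k),\hat u(x(k)))$, where $x(0)=x$, $x(k+1)=f(x(k),\hat u(x(k)))$ and $L=\min\{i\in\mathbb N\mid x(i)\in\mathcal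 T\}$. (With $v$ a guidance-barrier function for $\hat u$, this is the case for every $x\in\mathcal X$ with $v(x)>0$.) **Iterative scheme.** An initial feasible state-control trajectory is given: $x^0(0)=x_0$, $x^0(i+1)=f(x^0(i),u^0(i))$, $u^0(i)\in\mathcal U$, $x^0(i)\in\mathcal X$ for $0\le i\le L^0-1$, and $x^0(L^0)\in\mathcal T$, with $L^0$ the first hitting time of $\mathcal T$. For each $j\ge 0$, from the $j$-th trajectory $\{(x^j(i),u^j(i))\}_{i=0}^{L^j-1}$ one constructs by interpolation a feedback controller $\hat u^j:\mathcal X\to\mathcal U$ with $\hat u^j(x^j(i))=u^j(i)$, $i=0,\dots,L^j-1$, and then a guidance-barrier function $v^j$ of the system with $\hat u^j$. Put $\mathcal R^j=\{x\in\mathcal X\mid v^j(x)>0\}$. For iteration $j\ge1$ and time $t=0,1,2,\dots$, with current state $x_t^j$ ($x_0^j=x_0$), the problem $\mathrm{RAMPC}(j,t)$ is: minimize over $u_{0|t}^j,\dots,u_{N-1|t}^j$ $$\sum_{k=0}^{N-1}h(x_{k|t}^j,u_{k|t}^j)+Q(x_{N|t}^j,\pi_{\hat u^{j-1}})$$ subject to $x_{0|t}^j=x_t^j$; $x_{k+1|t}^j=f(x_{k|t}^j,u_{k|t}^j)$, $u_{k|t}^j\in\mathcal U$, $x_{k|t}^j\in\mathcal X$ for $k=0,\dots,N-1$; and the terminal constraint $v^{j-1}(x_{N|t}^j)\ge\lambda^N v^{j-1}(x_0)$ if $t=0$, and $v^{j-1}(x_{N|t}^j)\ge\lambda v^{j-1}(x_{N|t-1}^{j})$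 if $t\ge 1$, where $x_{N|t-1}^{j}$ is the terminal state of the optimal solution computed at time $t-1$. Feasible means that the constraint set is non-empty. Let $\{u_{i|t}^{*,j}\}_{i=0}^{N-1}$, $\{x_{i|t}^{*,j}\}_{i=0}^{N}$ denote an optimal solution of $\mathrm{RAMPC}(j,t)$ (optimal solutions are taken to exist). At time $t$ the input $u^j(t)=u_{0|t}^{*,j}$ is applied, and $x_{t+1}^j=x_{1|t}^{*,j}=f(x_t^j,u^j(t))$. Stopping rule: once there are $t\in\mathbb N$ and $l\le N$ with $x_{l|t}^{*,j}\in\mathcal T$ (take the smallest such $l$ at the first such $t$), no further optimization problems are solved in iteration $j$, and the inputs $u_{0|t}^{*,j},\dots,u_{l-1|t}^{*,j}$ are applied successively from the state $x_{0|t}^{*,j}$. The applied inputs and resulting states form the $j$-th trajectory $\{(x^j(i),u^j(i))\}_{0\le i\le L^j-1}$ with $x^j(L^j)\in\mathcal T$. **Standing assumption.** At each iteration $0\le j\le K$ the set $\mathcal R^j$ is non-empty and contains the state trajectory $\{x^j(i)\}_{i=0}^{L^j-1}$. *)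

(* Defs.v *)
(* MathComp / MathComp-Analysis *)
From mathcomp Require Import all_boot all_order all_algebra.
From mathcomp Require Import all_classical all_reals all_analysis.

Set Implicit Arguments.
Unset Strict Implicit.
Unset Printing Implicit Defensive.

Import Order.TTheory GRing.Theory Num.Theory.
Import numFieldNormedType.Exports.

Local Open Scope classical_set_scope.
Local Open Scope ring_scope.

Definition logb (R : realType) (b x : R) : R := ln x / ln b.

Definition first_hit (E : Type) (A : set E) (x : nat -> E) (L : nat) : Prop :=
  A (x L) /\ forall i, (i < L)%N -> ~ A (x i).

Record rampc_data (R : realType) (n m : nat) := RampcData {
  dyn : 'rV[R]_n -> 'rV[R]_m -> 'rV[R]_n;
  inputs : set 'rV[R]_m;
  safe_fun : 'rV[R]_n -> R;
  target_fun : 'rV[R]_n -> R;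
  stage_cost : 'rV[R]_n -> 'rV[R]_m -> R;
  x_init : 'rV[R]_n;
  lambda : R;
  barrier_bound : R;
  horizon : nat
}.

Section System.
Variables (R : realType) (n m : nat) (P : rampc_data R n m).

Local Notation state := 'rV[R]_n.
Local Notation input := 'rV[R]_m.
Local Notation f := (dyn P).
Local Notation U := (inputs P).
Local Notation h := (stage_cost P).
Local Notation N := (horizon P).

Definition safe : set state := [set x | safe_fun P x <= 0].

Definition target : set state := [set x | target_fun P x <= 0].

Definition reach_dom : set state :=
  [set y | exists x u, [/\ safe x, U u & y = f x u]] `|` safe.

Fixpoint traj (x : state) (u : nat -> input) (k : nat) : state :=
  if k is i.+1 then f (traj x u i) (u i) else x.

(* Controllers and barrier functions are total functions; only the values of
   controllers on [safe] and of barrier functions on [reach_dom] are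
   constrained or used. *)
Definition controller (uhat : state -> input) : Prop := set_fun safe U uhat.

Definition guidance_barrier (uhat : state -> input) (v : state -> R) : Prop :=
  [/\ [bounded v x | x in reach_dom],
      forall x, (safe `\` target) x -> v (f x (uhat x)) >= lambda P * v x,
      forall x, (reach_dom `\` safe) x -> v x <= 0,
      forall x, target x -> v x <= barrier_bound P
    & 0 < v (x_init P)].

Definition closed_loop (uhat : state -> input) (x : state) (k : nat) : state :=
  iter k (fun y => f y (uhat y)) x.

(* The hitting time defaults to 0 when the closed loop never reaches [target];
   terminal states satisfying the terminal constraint always reach it. *)
Definition terminal_cost (uhat : state -> input) (x : state) : R :=
  let L := xget 0%N [set L | first_hit target (closed_loop uhat x) L] in
  \sum_(0 <= k < L) h (closed_loop uhat x k) (uhat (closed_loop uhat x k)).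

(* The finite-horizon problem from the state [x], with terminal constraint
   [v x_N >= b].  Only the first N entries of the decision variable [u] are
   relevant; the predicted states are [traj x u k], for k <= N. *)
Definition ocp_admissible (v : state -> R) (x : state) (b : R)
    (u : nat -> input) : Prop :=
  (forall k, (k < N)%N -> U (u k) /\ safe (traj x u k)) /\
  v (traj x u N) >= b.

Definition ocp_cost (uhat : state -> input) (x : state) (u : nat -> input) : R :=
  \sum_(0 <= k < N) h (traj x u k) (u k) + terminal_cost uhat (traj x u N).

Definition ocp_optimal (uhat : state -> input) (v : state -> R) (x : state)
    (b : R) (u : nat -> input) : Prop :=
  ocp_admissible v x b u /\
  forall u', ocp_admissible v x b u' -> ocp_cost uhat x u <= ocp_cost uhat x u'.

End System.

(* A run of the iterative scheme: [trj_input S j] is the input sequence of the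
   j-th trajectory, of length [trj_len S j]; [opt_input S j t k] is the k-th
   input of the optimal solution computed at time t of iteration j. *)
Record rampc_run (R : realType) (n m : nat) := RampcRun {
  trj_input : nat -> nat -> 'rV[R]_m;
  trj_len : nat -> nat;
  ctrl : nat -> 'rV[R]_n -> 'rV[R]_m;
  barrier : nat -> 'rV[R]_n -> R;
  opt_input : nat -> nat -> nat -> 'rV[R]_m
}.

Section Scheme.
Variables (R : realType) (n m : nat).
Variables (P : rampc_data R n m) (S : rampc_run R n m).

Local Notation x0 := (x_init P).
Local Notation N := (horizon P).

Definition trj_state (j i : nat) : 'rV[R]_n := traj P x0 (trj_input S j) i.

(* x_t^j, the closed-loop state under the first inputs u_{0|s}^{*,j}, s < t *)
Definition cur_state (j t : nat) : 'rV[R]_n :=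
  traj P x0 (fun s => opt_input S j s 0%N) t.

Definition pred_state (j t k : nat) : 'rV[R]_n :=
  traj P (cur_state j t) (opt_input S j t) k.

Definition terminal_bound (j t : nat) : R :=
  if t is s.+1 then lambda P * barrier S j.-1 (pred_state j s N)
  else lambda P ^+ N * barrier S j.-1 x0.

Definition rampc_feasible (j t : nat) : Prop :=
  exists u, ocp_admissible P (barrier S j.-1) (cur_state j t)
              (terminal_bound j t) u.

Definition rampc_solved (j t : nat) : Prop :=
  ocp_optimal P (ctrl S j.-1) (barrier S j.-1) (cur_state j t)
    (terminal_bound j t) (opt_input S j t).

Definition running (j t : nat) : Prop :=
  forall s l, (s < t)%N -> (l <= N)%N -> ~ target P (pred_state j s l).

Definition stops (j t l : nat) : Prop :=
  [/\ running j t, (l <= N)%N & first_hit (target P) (pred_state j t) l].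

Definition terminates (j : nat) : Prop := exists t l, stops j t l.

(* Iteration 0 is the given initial trajectory. *)
Definition completed (j : nat) : Prop := j = 0%N \/ terminates j.

Definition initial_trajectory : Prop :=
  (forall i, (i < trj_len S 0)%N ->
     inputs P (trj_input S 0 i) /\ safe P (trj_state 0 i)) /\
  first_hit (target P) (trj_state 0) (trj_len S 0).

(* The inputs u_{0|i}^* are applied for i < t, then u_{0|t}^*, ..., u_{l-1|t}^*. *)
Definition records_trajectory (j t l : nat) : Prop :=
  trj_len S j = (t + l)%N /\
  forall i, (i < t + l)%N ->
    trj_input S j i =
      if (i < t)%N then opt_input S j i 0%N else opt_input S j t (i - t)%N.

Definition interpolates (j : nat) : Prop :=
  controller P (ctrl S j) /\
  forall i, (i < trj_len S j)%N -> ctrl S j (trj_state j i) = trj_input S j i.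

Definition barrier_region (j : nat) : set 'rV[R]_n :=
  [set x | safe P x /\ 0 < barrier S j x].

Definition region_contains_trajectory (j : nat) : Prop :=
  barrier_region j !=set0 /\
  forall i, (i < trj_len S j)%N -> barrier_region j (trj_state j i).

End Scheme.

(* Main.v *)
(* The terminal constraints force v(x_{N|t}) >= lambda^(N+t) v(x_0), where
   v = v^{j-1}.  A safe state x with v(x) > 0 satisfies v(x) <= M: otherwise the
   closed loop under the previous controller starting from x never meets the
   target (where v <= M), stays safe, and multiplies v by at least lambda at
   each step, contradicting the boundedness of v.  Hence
   lambda^(N+t) v(x_0) <= M at every time t at which a problem is solved, which
   bounds the number of such times; since the applied tail has length l <= N,
   the same inequality bounds the length t + l of the trajectory.  Feasibility
   is propagated by shifting the previous optimal input sequence and appending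
   the previous controller's input at its terminal state. *)
Require Import Defs.
From mathcomp Require Import all_boot all_order all_algebra.
From mathcomp Require Import all_classical all_reals all_analysis.
Import Order.TTheory GRing.Theory Num.Theory.
Import numFieldNormedType.Exports.
Local Open Scope classical_set_scope.
Local Open Scope ring_scope.

(** * Geometric growth and logarithms *)

Lemma logb_ge_exponent {R : realType} {a x y : R} {k : nat} :
  1 < a -> 0 < x -> a ^+ k * x <= y -> k%:R <= logb a (y / x).
Proof.
move=> a1 x0 le_y; have a0 : 0 < a by rewrite (lt_trans _ a1).
rewrite /logb ler_pdivlMr ?ln_gt0// mulr_natl -lnXn//.
have ak0 : 0 < a ^+ k by rewrite exprn_gt0.
have le_q : a ^+ k <= y / x by rewrite ler_pdivlMr.
by rewrite ler_ln ?posrE// (lt_le_trans ak0).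
Qed.

Lemma geometric_unbounded {R : realType} {a x : R} (y : R) :
  1 < a -> 0 < x -> exists k, y < a ^+ k * x.
Proof.
(* This integer exceeds [logb a (y / x)], so [a ^+ k * x <= y] would contradict [logb_ge_exponent].
   Here [y] may have any sign. *)
move=> a1 x0; exists (Num.bound `|logb a (y / x)|).
rewrite ltNge; apply/negP => /(logb_ge_exponent a1 x0).
by rewrite leNgt (le_lt_trans (ler_norm _) (archi_boundP (normr_ge0 _))).
Qed.

Section Trajectories.
Context {R : realType} {n m : nat} (P : rampc_data R n m).

Lemma eq_traj x (u w : nat -> 'rV[R]_m) k :
  (forall i, (i < k)%N -> u i = w i) -> traj P x u k = traj P x w k.
Proof.
elim: k => //= k IH uw; rewrite IH ?uw// => i ik.
by rewrite uw// (ltn_trans ik).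
Qed.

Lemma traj_add x (u : nat -> 'rV[R]_m) s k :
  traj P x u (s + k) = traj P (traj P x u s) (fun i => u (s + i)%N) k.
Proof. by elim: k => [|k IH]; rewrite ?addn0 ?addnS//= IH. Qed.

Lemma traj_reach_dom x (u : nat -> 'rV[R]_m) k : (0 < k)%N ->
  (forall i, (i < k)%N -> inputs P (u i) /\ safe P (traj P x u i)) ->
  reach_dom P (traj P x u k).
Proof.
case: k => // k _ /(_ k (ltnSn k))[Uu Xx]; left.
by exists (traj P x u k), (u k).
Qed.

End Trajectories.

(** * Guidance barriers along a fixed controller *)

Section Barrier.
Context {R : realType} {n m : nat} {P : rampc_data R n m}.
Context {uhat : 'rV[R]_n -> 'rV[R]_m} {v : 'rV[R]_n -> R}.
Hypotheses (lambda_gt1 : 1 < lambda P) (uhatU : controller P uhat).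
Hypothesis gb : guidance_barrier P uhat v.

Lemma barrier_safe x : reach_dom P x -> 0 < v x -> safe P x.
Proof.
case: gb => _ _ vout _ _ Yx vx; apply: contrapT => Xx.
by move: vx; rewrite ltNge vout.
Qed.

Lemma barrier_step x : safe P x -> ~ target P x -> 0 < v x ->
  safe P (dyn P x (uhat x)) /\ lambda P * v x <= v (dyn P x (uhat x)).
Proof.
move=> Xx Tx vx; have le_v : lambda P * v x <= v (dyn P x (uhat x)).
  by case: gb => _ + _ _ _; apply.
split=> //; apply: barrier_safe.
  by left; exists x, (uhat x); split=> //; apply: uhatU.
by rewrite (lt_le_trans _ le_v)// mulr_gt0// (lt_trans _ lambda_gt1).
Qed.

Lemma barrier_le_bound x : safe P x -> 0 < v x -> v x <= barrier_bound P.
Proof.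
move=> Xx vx; rewrite leNgt; apply/negP => Mv.
have lambda_gt0 : 0 < lambda P by rewrite (lt_trans _ lambda_gt1).
have grow k : safe P (closed_loop P uhat x k) /\
    lambda P ^+ k * v x <= v (closed_loop P uhat x k).
  elim: k => [|k [Xk vk]]; first by rewrite mul1r.
  have ltvk : barrier_bound P < v (closed_loop P uhat x k).
    rewrite (lt_le_trans Mv)// (le_trans _ vk)// ler_peMl ?(ltW vx)//.
    by rewrite exprn_ege1// ltW.
  have Tk : ~ target P (closed_loop P uhat x k).
    by case: gb => _ _ _ vT _ /vT; rewrite leNgt ltvk.
  have vk0 : 0 < v (closed_loop P uhat x k).
    by rewrite (lt_le_trans _ vk)// mulr_gt0// exprn_gt0.
  have [XS vS] := barrier_step _ Xk Tk vk0; split=> //.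
  by rewrite (le_trans _ vS)// exprS -mulrA ler_pM2l.
(* Boundedness provides a threshold [B] such that every real strictly above it bounds [v] in norm,
   hence the choice of [B + 1]. *)
case: gb => -[B [_ /(_ (B + 1))]]; rewrite ltrDl ltr01 => /(_ isT) vB _ _ _ _.
have [k ltk] := geometric_unbounded (B + 1) lambda_gt1 vx.
have [Xk vk] := grow k.
have /(le_trans (ler_norm _)) := vB _ (or_intror Xk).
by rewrite leNgt (lt_le_trans ltk vk).
Qed.

End Barrier.

(** * A single iteration of the scheme *)

Section Iteration.
Context {R : realType} {n m : nat} {P : rampc_data R n m} {S : rampc_run R n m}.
Context {j : nat}.
Hypotheses (lambda_gt1 : 1 < lambda P) (horizon_gt0 : (0 < horizon P)%N).
Hypothesis ctrlU : controller P (ctrl S j.-1).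
Hypothesis gb : guidance_barrier P (ctrl S j.-1) (barrier S j.-1).
Hypothesis feasible0 : rampc_feasible P S j 0.
Hypothesis solved : forall t, running P S j t ->
  rampc_feasible P S j t -> rampc_solved P S j t.

(** The input applied at time [t] is the first entry of the optimal plan, so the predicted state of
    index 1 is the next closed-loop state. *)
Lemma pred_state_shift t k :
  pred_state P S j t k.+1 =
  traj P (cur_state P S j t.+1) (fun i => opt_input S j t i.+1) k.
Proof. exact: (traj_add P _ _ 1 k). Qed.

Lemma runningW s t : (s <= t)%N -> running P S j t -> running P S j s.
Proof. by move=> st run i l /leq_trans/(_ st); apply: run. Qed.

Lemma running_stops t l : running P S j t -> (l <= horizon P)%N ->
  target P (pred_state P S j t l) -> exists l', stops P S j t l'.
Proof.
move=> run lN Tl.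
(* Membership in the target is restated as a boolean inequality, so that [ex_minnP] supplies the
   least hitting index. *)
have ex : exists k, target_fun P (pred_state P S j t k) <= 0 by exists l.
case: (ex_minnP ex) => k Tk kmin; exists k; split=> //.
  by rewrite (leq_trans _ lN)// kmin.
by split=> // i; rewrite ltnNge => + Ti; rewrite kmin.
Qed.

Lemma running_or_terminates t : running P S j t \/ terminates P S j.
Proof.
elim: t => [|t [run|]]; [by left| |by right].
have [[l [lN Tl]]|noT] := pselect (exists l,
    (l <= horizon P)%N /\ target P (pred_state P S j t l)).
  by right; exists t; apply: running_stops lN Tl.
left=> s l; rewrite ltnS leq_eqVlt => /predU1P[-> lN Tl|]; last exact: run.
by apply: noT; exists l.
Qed.

Let v := barrier S j.-1.
Let v0_gt0 : 0 < v (x_init P). Proof. by case: gb. Qed.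
Let lambda_gt0 : 0 < lambda P. Proof. exact: lt_trans lambda_gt1. Qed.

Let growth t := lambda P ^+ (horizon P + t) * v (x_init P).

(** The problem imposes safety only at indices below the horizon. Since the horizon is positive, the
    terminal state is the image of a safe state under an admissible input, hence in [reach_dom],
    where a positive barrier value forces safety. *)
Lemma solved_terminal t : rampc_solved P S j t ->
  growth t <= terminal_bound P S j t ->
  growth t <= v (pred_state P S j t (horizon P)) /\
  safe P (pred_state P S j t (horizon P)).
Proof.
move=> [[adm vN] _] le_b; have le_v := le_trans le_b vN; split=> //.
apply: (barrier_safe gb); first exact: traj_reach_dom.
by rewrite (lt_le_trans _ le_v)// mulr_gt0// exprn_gt0.
Qed.

(** The two claims need a joint induction: feasibility at [t] gives an optimal plan, the growth
    bound makes its terminal state safe with positive barrier value, and from such a state the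
    previous controller can extend the plan. *)
Lemma running_feasible t : running P S j t ->
  rampc_feasible P S j t /\ growth t <= terminal_bound P S j t.
Proof.
elim: t => [|t IH] run.
  by split=> //; rewrite /growth addn0.
have run_t := runningW _ _ (leqnSn t) run.
have [feas le_b] := IH run_t; have sol := solved _ run_t feas.
have [le_v XN] := solved_terminal _ sol le_b.
(* Running at [t.+1] excludes hits by the whole plan of time [t], its terminal state included, so
   [barrier_step] applies there. *)
have TN : ~ target P (pred_state P S j t (horizon P)) by apply: run.
have vN0 : 0 < v (pred_state P S j t (horizon P)).
  by rewrite (lt_le_trans _ le_v)// mulr_gt0// exprn_gt0.
have [_ vS] := barrier_step lambda_gt1 ctrlU gb _ XN TN vN0.
split; last by rewrite /growth addnS exprS -mulrA ler_pM2l.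
case: sol => -[adm _] _.
move: horizon_gt0 adm TN XN vN0 vS le_v; rewrite /rampc_feasible /ocp_admissible /=.
case: (horizon P) => // N _ adm TN XN vN0 vS le_v.
(* [N] is now the horizon minus one: index [N] of the new plan is its last input, applied at the old
   terminal state, of index [N.+1]. *)
pose w k := if (k < N)%N then opt_input S j t k.+1
  else ctrl S j.-1 (pred_state P S j t N.+1).
have trajw k : (k <= N)%N ->
    traj P (cur_state P S j t.+1) w k = pred_state P S j t k.+1.
  move=> kN; rewrite pred_state_shift; apply: eq_traj => i ik.
  by rewrite /w (leq_trans ik kN).
exists w; split=> [k|].
  rewrite ltnS => kN; rewrite trajw//.
  move: kN; rewrite leq_eqVlt /w => /predU1P[->|kN].
    by rewrite ltnn; split=> //; apply: ctrlU.
  by rewrite kN; apply: adm.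
by rewrite /= trajw// /w ltnn.
Qed.

Lemma running_growth t : running P S j t -> growth t <= barrier_bound P.
Proof.
move=> run; have [feas le_b] := running_feasible _ run.
have [le_v XN] := solved_terminal _ (solved _ run feas) le_b.
rewrite (le_trans le_v)// (barrier_le_bound lambda_gt1 ctrlU gb)//.
by rewrite (lt_le_trans _ le_v)// mulr_gt0// exprn_gt0.
Qed.

Lemma iteration_terminates : terminates P S j.
Proof.
have [k ltk] := geometric_unbounded (barrier_bound P) lambda_gt1 v0_gt0.
have [/running_growth le_M|//] := running_or_terminates k.
(* The exponent in [growth k] is the horizon plus [k], hence at least [k]. *)
move: ltk; rewrite ltNge (le_trans _ le_M)// ler_pM2r//.
by rewrite ler_weXn2l// ?leq_addl// ltW.
Qed.

Lemma stops_length t l : stops P S j t l ->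
  (t + l)%:R <= logb (lambda P) (barrier_bound P / v (x_init P)).
Proof.
move=> [run lN _]; apply: logb_ge_exponent => //.
rewrite (le_trans _ (running_growth _ run))// ler_pM2r//.
by rewrite ler_weXn2l ?(ltW lambda_gt1)// addnC leq_add2r.
Qed.

Lemma recorded_state t l : records_trajectory S j t l ->
  (forall i, (i <= t)%N -> trj_state P S j i = cur_state P S j i) /\
  (forall k, (k <= l)%N -> trj_state P S j (t + k) = pred_state P S j t k).
Proof.
move=> [_ rec].
(* The case [i = t] is included because the state at [t] depends only on inputs before [t]; the tail
   therefore starts at [cur_state P S j t]. *)
have early i : (i <= t)%N -> trj_state P S j i = cur_state P S j i.
  move=> it; apply: eq_traj => s si; have st := leq_trans si it.
  by rewrite rec ?st// (leq_trans st)// leq_addr.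
split=> // k kl; rewrite /trj_state traj_add -/(trj_state P S j t) early//.
apply: eq_traj => s sk; rewrite rec ?ltn_add2l ?(leq_trans sk)//.
by rewrite ltnNge leq_addr addKn.
Qed.

(** Before [t], each step inherits the index 0 constraints of its own problem. From [t] on, the
    constraints of the last problem apply, at indices below [l], which is at most the horizon. *)
Lemma recorded_admissible t l : stops P S j t l -> records_trajectory S j t l ->
  forall i, (i < t + l)%N ->
    safe P (trj_state P S j i) /\ inputs P (trj_input S j i).
Proof.
move=> [run lN _] rec i itl.
have adm s k : (s <= t)%N -> (k < horizon P)%N ->
    inputs P (opt_input S j s k) /\ safe P (pred_state P S j s k).
  move=> st; have run_s := runningW _ _ st run.
  have [feas _] := running_feasible _ run_s.
  by case: (solved _ run_s feas) => -[+ _] _; apply.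
have [early late] := recorded_state _ _ rec.
case: rec => _ ->//; have [it|ti] := ltnP i t.
  by rewrite early ?(ltnW it)//; case: (adm i 0%N (ltnW it) horizon_gt0).
have kl : (i - t < l)%N by rewrite ltn_subLR.
rewrite -(subnKC ti) late ?(ltnW kl)// addKn.
by case: (adm t (i - t)%N (leqnn t) (leq_trans kl lN)).
Qed.

End Iteration.

Theorem theorem2 (R : realType) (n m K : nat)
  (P : rampc_data R n m) (S : rampc_run R n m)
  (lambda_gt1 : 1 < lambda P)
  (bound_gt0 : 0 < barrier_bound P)
  (horizon_gt0 : (0 < horizon P)%N)
  (target_safe : target P `<=` safe P)
  (x_init_in : (safe P `\` target P) (x_init P))
  (cost_continuous :
     continuous (fun p : 'rV[R]_n * 'rV[R]_m => stage_cost P p.1 p.2))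
  (cost_ge0 : forall x u, safe P x -> inputs P u -> 0 <= stage_cost P x u)
  (initial : initial_trajectory P S)
  (learned : forall j, (j <= K)%N -> completed P S j ->
     interpolates P S j /\ guidance_barrier P (ctrl S j) (barrier S j))
  (standing : forall j, (j <= K)%N -> completed P S j ->
     region_contains_trajectory P S j)
  (initially_feasible : forall j, (1 <= j <= K)%N -> rampc_feasible P S j 0)
  (solved : forall j t, (1 <= j <= K)%N -> running P S j t ->
     rampc_feasible P S j t -> rampc_solved P S j t)
  (recorded : forall j t l, (1 <= j <= K)%N -> stops P S j t l ->
     records_trajectory S j t l) :
  forall j, (1 <= j <= K)%N ->
    (forall t, (1 <= t <= (trj_len S j).-1)%N -> running P S j t ->
       rampc_feasible P S j t) /\
    [/\ terminates P S j,
        forall i, (i < trj_len S j)%N ->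
          safe P (trj_state P S j i) /\ inputs P (trj_input S j i),
        target P (trj_state P S j (trj_len S j))
      & (trj_len S j)%:R <=
          logb (lambda P) (barrier_bound P / barrier S j.-1 (x_init P))].
Proof.
(* The controller and barrier of iteration [j.-1] are known to be valid only once that iteration is
   completed. One iteration is thus treated conditionally, and induction in [cmpl] removes the
   condition. *)
have iter j : (1 <= j <= K)%N -> completed P S j.-1 ->
    (forall t, running P S j t -> rampc_feasible P S j t) /\
    [/\ terminates P S j,
        forall i, (i < trj_len S j)%N ->
          safe P (trj_state P S j i) /\ inputs P (trj_input S j i),
        target P (trj_state P S j (trj_len S j))
      & (trj_len S j)%:R <=
          logb (lambda P) (barrier_bound P / barrier S j.-1 (x_init P))].
  move=> jK cmpl; have jK' : (j.-1 <= K)%N.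
    by case/andP: jK => _; apply: leq_trans; apply: leq_pred.
  have [[ctrlU _] gb] := learned _ jK' cmpl.
  have feas0 := initially_feasible _ jK.
  have solv := fun t => solved j t jK.
  split=> [t run|].
    by case: (running_feasible lambda_gt1 horizon_gt0 ctrlU gb feas0 solv _ run).
  have term := iteration_terminates lambda_gt1 horizon_gt0 ctrlU gb feas0 solv.
  have [t [l st]] := term.
  have rec := recorded _ _ _ jK st.
  have [_ late] := recorded_state (P := P) _ _ rec; have [-> _] := rec; split=> //.
  - exact: (recorded_admissible lambda_gt1 horizon_gt0 ctrlU gb feas0 solv
      _ _ st rec).
  - by rewrite late//; case: st => _ _ [].
  - exact: (stops_length lambda_gt1 horizon_gt0 ctrlU gb feas0 solv _ _ st).
have cmpl j : (j <= K)%N -> completed P S j.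
  elim: j => [|j IH] jK; first by left.
  by right; case: (iter j.+1 jK (IH (ltnW jK))) => _ [].
move=> j jK; have [|feas concl] := iter j jK.
  by apply: cmpl; case/andP: jK => _; apply: leq_trans; apply: leq_pred.
by split=> // t _; apply: feas.
Qed.
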